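(* Let $k$ be a field and let $Q$ be an interval finite quiver. Let $p$ be a left infinite path in $Q$ such that the representation $Y_{[p]}$ is finitely presented. Then $Y_{[p]}$ is an indecomposable injective object in $\mathrm{fp}(Q)$.
   Context: A quiver $Q=(Q_0,Q_1)$ has a (possibly infinite) vertex set $Q_0$ and arrow set $Q_1$; an arrow $\alpha$ goes from its source $s(\alpha)$ to its target $t(\alpha)$. Paths are written right to left, $\alpha_l\cdots\alpha_1$ with $s(\alpha_{i+1})=t(\alpha_i)$, and each vertex $a$ has a trivial path $e_a$. $Q(a,b)$ is the set of paths from $a$ to $b$ (including trivial ones). $Q$ is interval finite if $Q(a,b)$ is finite for all $a,b\in Q_0$. A left infinite path is an infinite sequence of arrows $p=\cdots\alpha_n\cdots\alpha_2\alpha_1$ with $s(\alpha_{i+1})=t(\alpha_i)$ for all $i\ge1$; $s(p)=s(\alpha_1)$. Two left infinite paths $\cdots\alpha_2\alpha_1$ and $\cdots\beta_2\beta_1$ are equivalent if there are positive integers $m,n$ with $\cdots\alpha_{m+1}\alpha_m=\cdots\beta_{n+1}\beta_n$ (as sequences). $[p]$ is the equivalence class of $p$ and $[p]_a$ is the set of $u\in[p]$ with $s(u)=a$. $\mathrm{Rep}(Q)$ is the abelian category of representations $M=(M(a),M(\alpha))$ of $Q$ by (arbitrary) $k$-vector spaces and linear maps. $P_a$ is the representation with $P_a(b)=\bigoplus_{p\in Q(a,b)}kp$ and $P_a(\alpha)(p)=\alpha p$. $Y_{[p]}$ is the representation with $Y_{[p]}(a)=\mathrm{Hom}_k(\bigoplus_{u\in[p]_a}ku,k)$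 and, for $\alpha:a\to b$, $Y_{[p]}(\alpha)(f)=(u\mapsto f(u\alpha))$. $M$ is finitely generated if there is an epimorphism $f:\bigoplus_{i=1}^nP_{a_i}\to M$ (finite sum), and finitely presented if moreover $\operatorname{Ker}f$ is finitely generated. $\mathrm{fp}(Q)$ is the full subcategory of $\mathrm{Rep}(Q)$ of finitely presented representations; it is an abelian subcategory (kernels and cokernels as in $\mathrm{Rep}(Q)$). An injective object in $\mathrm{fp}(Q)$ is an injective object of this abelian category. *)

(* Defs.v *)
From HB Require Import structures.
From mathcomp Require Import all_boot all_order all_algebra.
From mathcomp Require Import mathcomp_extra boolp classical_sets functions.
From mathcomp Require Import cardinality.
From mathcomp Require Import finmap monalg.

Set Implicit Arguments.
Unset Strict Implicit.
Unset Printing Implicit Defensive.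

Import GRing.Theory.
Local Open Scope fset_scope.
Local Open Scope ring_scope.

(* [{linear U -> V}], with its pointwise structure, is [Hom_k(U, V)]. *)
Section LinearMaps.
Variables (k : fieldType) (U V : lmodType k).
Implicit Types f g : {linear U -> V}.

Definition lin_zero : {linear U -> V} := \0.
Definition lin_opp f : {linear U -> V} := \- f.
Definition lin_add f g : {linear U -> V} := f \+ g.
Definition lin_scale (c : k) f : {linear U -> V} := c \*: f.

Lemma lin_eqP f g : f =1 g -> f = g.
Proof.
move=> e; have {}e : (f : U -> V) = g by apply/funext.
case: f g e => [f [[fz] [fs]]] [g [[gz] [gs]]] /= e; subst g.
by rewrite (Prop_irrelevance fz gz) (Prop_irrelevance fs gs).
Qed.

Fact lin_addA : associative lin_add.
Proof. by move=> f g h; apply: lin_eqP => x /=; rewrite addrA. Qed.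
Fact lin_addC : commutative lin_add.
Proof. by move=> f g; apply: lin_eqP => x /=; rewrite addrC. Qed.
Fact lin_add0 : left_id lin_zero lin_add.
Proof. by move=> f; apply: lin_eqP => x /=; rewrite add0r. Qed.
Fact lin_addN : left_inverse lin_zero lin_opp lin_add.
Proof. by move=> f; apply: lin_eqP => x /=; rewrite addNr. Qed.

HB.instance Definition _ := gen_eqMixin {linear U -> V}.
HB.instance Definition _ := gen_choiceMixin {linear U -> V}.
HB.instance Definition _ := GRing.isZmodule.Build {linear U -> V}
  lin_addA lin_addC lin_add0 lin_addN.

Fact lin_scaleA a b f : lin_scale a (lin_scale b f) = lin_scale (a * b) f.
Proof. by apply: lin_eqP => x /=; rewrite scalerA. Qed.
Fact lin_scale1 : left_id 1 lin_scale.
Proof. by move=> f; apply: lin_eqP => x /=; rewrite scale1r. Qed.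
Fact lin_scaleDr : right_distributive lin_scale +%R.
Proof. by move=> a f g; apply: lin_eqP => x /=; rewrite scalerDr. Qed.
Fact lin_scaleDl f : {morph lin_scale^~ f : a b / a + b}.
Proof. by move=> a b; apply: lin_eqP => x /=; rewrite scalerDl. Qed.

HB.instance Definition _ := GRing.Zmodule_isLmodule.Build k {linear U -> V}
  lin_scaleA lin_scale1 lin_scaleDr lin_scaleDl.

End LinearMaps.

Section Kernel.
Variables (k : fieldType) (U V : lmodType k) (f : {linear U -> V}).

Definition ker_pred : {pred U} := fun x => f x == 0.

Fact ker_submod_closed : submod_closed ker_pred.
Proof.
split=> [|c x y]; rewrite !unfold_in ?linear0 ?eqxx //.
by move=> /eqP fx /eqP fy; rewrite linearP fx fy scaler0 addr0.
Qed.
HB.instance Definition _ :=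
  GRing.isSubmodClosed.Build k U ker_pred ker_submod_closed.

Record ker_space := KerSpace { ker_val : U; _ : ker_val \in ker_pred }.
HB.instance Definition _ := [isSub for ker_val].
HB.instance Definition _ := [Choice of ker_space by <:].
HB.instance Definition _ := [SubChoice_isSubLmodule of ker_space by <:].

End Kernel.

(* [{malg k[X]}] is used as the free vector space [(+)_(x in X) k x];
   [free_map g] is the linear extension of [g], which need not be injective. *)
Section FreeMap.
Variables (k : fieldType) (X Y : choiceType) (g : X -> Y).

Definition free_map (u : {malg k[X]}) : {malg k[Y]} :=
  \sum_(x <- msupp u) << u@_x *g g x >>.

Fact free_map_linear : linear free_map.
Proof.
have Fw (d : {fset X}) (u : {malg k[X]}) : (msupp u `<=` d)%fset ->
    free_map u = \sum_(x <- d) << u@_x *g g x >>.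
  move=> sud; apply: big_fset_incl => // x _ /mcoeff_outdom ->.
  by rewrite monalgU0.
move=> c u v; pose d := (msupp u `|` msupp v)%fset.
have su : (msupp u `<=` d)%fset by exact: fsubsetUl.
have sv : (msupp v `<=` d)%fset by exact: fsubsetUr.
have sw : (msupp (c *: u + v) `<=` d)%fset.
  apply: fsubset_trans (msuppD_le _ _) _.
  by rewrite fsubUset sv andbT (fsubset_trans (msuppZ_le _ _) su).
rewrite (Fw d _ su) (Fw d _ sv) (Fw d _ sw) scaler_sumr -big_split /=.
apply: eq_bigr => x _; apply/malgP => y.
by rewrite !(mcoeffsE, mcoeffZ) mulrnDl mulrnAr.
Qed.
HB.instance Definition _ := GRing.isLinear.Build k {malg k[X]} {malg k[Y]} _
  free_map free_map_linear.

End FreeMap.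

Record quiver := Quiver {
  vertex : Type;
  arrow : Type;
  src : arrow -> vertex;
  tgt : arrow -> vertex
}.
Arguments src {q}.
Arguments tgt {q}.

(* [pcons al p] is [al p], in the right to left notation. *)
Inductive qpath (Q : quiver) (a : vertex Q) : vertex Q -> Type :=
| ptriv : qpath a a
| pcons (al : arrow Q) : qpath a (src al) -> qpath a (tgt al).

HB.instance Definition _ (Q : quiver) (a b : vertex Q) :=
  gen_eqMixin (qpath a b).
HB.instance Definition _ (Q : quiver) (a b : vertex Q) :=
  gen_choiceMixin (qpath a b).

Definition interval_finite (Q : quiver) : Prop :=
  forall a b : vertex Q, finite_set [set: qpath a b].

(* The [i]-th arrow, counted from [0], is [alpha_(i+1)]. *)
Record lpath (Q : quiver) := LPath {
  larrow :> nat -> arrow Q;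
  larrowP : forall i, src (larrow i.+1) = tgt (larrow i)
}.

Definition lsrc (Q : quiver) (p : lpath Q) : vertex Q := src (p 0%N).

Definition lequiv (Q : quiver) (p q : lpath Q) : Prop :=
  exists m n : nat, forall i, p (m + i)%N = q (n + i)%N.

Section LCons.
Variables (Q : quiver) (al : arrow Q) (u : lpath Q) (h : lsrc u = tgt al).

Definition lcons_arrow (i : nat) : arrow Q := if i is j.+1 then u j else al.

Fact lcons_arrowP i : src (lcons_arrow i.+1) = tgt (lcons_arrow i).
Proof. by case: i => [|i] /=; [exact: h | exact: larrowP]. Qed.

(* the left infinite path [u al] *)
Definition lcons : lpath Q := LPath lcons_arrowP.

Lemma lequiv_lcons (p : lpath Q) : lequiv p u -> lequiv p lcons.
Proof. by move=> [m [n e]]; exists m, n.+1. Qed.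

End LCons.

(* [lclass p a] is [[p]_a]. *)
Record lclass (Q : quiver) (p : lpath Q) (a : vertex Q) := LClass {
  lclass_val : lpath Q;
  lclass_equiv : lequiv p lclass_val;
  lclass_src : lsrc lclass_val = a
}.

HB.instance Definition _ (Q : quiver) (p : lpath Q) (a : vertex Q) :=
  gen_eqMixin (lclass p a).
HB.instance Definition _ (Q : quiver) (p : lpath Q) (a : vertex Q) :=
  gen_choiceMixin (lclass p a).

Definition lclass_cons (Q : quiver) (p : lpath Q) (al : arrow Q)
    (u : lclass p (tgt al)) : lclass p (src al) :=
  @LClass Q p (src al) (lcons (lclass_src u))
    (lequiv_lcons (lclass_src u) (lclass_equiv u)) erefl.

Record rep (k : fieldType) (Q : quiver) := Rep {
  rep_obj :> vertex Q -> lmodType k;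
  rep_map : forall al : arrow Q, {linear rep_obj (src al) -> rep_obj (tgt al)}
}.

Record rep_hom (k : fieldType) (Q : quiver) (M N : rep k Q) := Hom {
  hom_fun :> forall a, {linear M a -> N a};
  homP : forall (al : arrow Q) (x : M (src al)),
    hom_fun (tgt al) (rep_map M al x) = rep_map N al (hom_fun (src al) x)
}.

Section Category.
Variables (k : fieldType) (Q : quiver).
Implicit Types M N L : rep k Q.

Definition hom_eq M N (f g : rep_hom M N) : Prop := forall a, f a =1 g a.

Fact hom_idP M (al : arrow Q) (x : M (src al)) :
  (idfun : {linear M (tgt al) -> M (tgt al)}) (rep_map M al x)
  = rep_map M al ((idfun : {linear M (src al) -> M (src al)}) x).
Proof. by []. Qed.
Definition hom_id M : rep_hom M M :=
  @Hom k Q M M (fun a => (idfun : {linear M a -> M a})) (@hom_idP M).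

Section Comp.
Variables (M N L : rep k Q) (g : rep_hom N L) (f : rep_hom M N).
Fact hom_compP (al : arrow Q) (x : M (src al)) :
  (g (tgt al) \o f (tgt al)) (rep_map M al x)
  = rep_map L al ((g (src al) \o f (src al)) x).
Proof. by rewrite /= !homP. Qed.
Definition hom_comp : rep_hom M L :=
  @Hom k Q M L (fun a => (g a \o f a : {linear M a -> L a})) hom_compP.
End Comp.

Definition isomorphic M N : Prop :=
  exists (f : rep_hom M N) (g : rep_hom N M),
    hom_eq (hom_comp g f) (hom_id M) /\ hom_eq (hom_comp f g) (hom_id N).

Definition is_zero M : Prop := forall a (x : M a), x = 0.

Definition zero_rep : rep k Q :=
  @Rep k Q (fun=> 'rV[k]_0 : lmodType k) (fun=> \0).

Section DirectSum.
Variables M N : rep k Q.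
Definition dsum_map (al : arrow Q) (x : (M (src al) * N (src al))%type) :
    (M (tgt al) * N (tgt al))%type :=
  (rep_map M al x.1, rep_map N al x.2).
Fact dsum_map_linear al : linear (dsum_map (al := al)).
Proof. by move=> c x y; rewrite /dsum_map /= !linearP. Qed.
HB.instance Definition _ al := GRing.isLinear.Build k
  (M (src al) * N (src al))%type (M (tgt al) * N (tgt al))%type _
  (dsum_map (al := al)) (@dsum_map_linear al).
Definition dsum : rep k Q :=
  @Rep k Q (fun a => (M a * N a)%type : lmodType k)
    (fun al => dsum_map (al := al)).
End DirectSum.

Section KernelRep.
Variables (M N : rep k Q) (f : rep_hom M N).
Fact ker_mapP (al : arrow Q) (x : ker_space (f (src al))) :
  rep_map M al (val x) \in ker_pred (f (tgt al)).
Proof.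
have /eqP fx : f (src al) (val x) == 0 := valP x.
by apply/eqP; rewrite homP fx linear0.
Qed.
Definition ker_map (al : arrow Q) (x : ker_space (f (src al))) :
  ker_space (f (tgt al)) := KerSpace (ker_mapP x).
Fact ker_map_linear al : linear (ker_map (al := al)).
Proof. by move=> c x y; apply/val_inj; rewrite /= linearP. Qed.
HB.instance Definition _ al := GRing.isLinear.Build k
  (ker_space (f (src al))) (ker_space (f (tgt al))) _
  (ker_map (al := al)) (@ker_map_linear al).
Definition ker_rep : rep k Q :=
  @Rep k Q (fun a => ker_space (f a) : lmodType k)
    (fun al => ker_map (al := al)).
End KernelRep.

(* Morphisms and objects are taken in the full subcategory of [Rep(Q)] whose
   objects satisfy [C]. *)
Definition epi_in (C : rep k Q -> Prop) M N (f : rep_hom M N) : Prop :=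
  forall L, C L -> forall g h : rep_hom N L,
    hom_eq (hom_comp g f) (hom_comp h f) -> hom_eq g h.

Definition mono_in (C : rep k Q -> Prop) M N (f : rep_hom M N) : Prop :=
  forall L, C L -> forall g h : rep_hom L M,
    hom_eq (hom_comp f g) (hom_comp f h) -> hom_eq g h.

Definition injective_in (C : rep k Q -> Prop) (I : rep k Q) : Prop :=
  C I /\
  forall M N, C M -> C N -> forall (i : rep_hom M N) (f : rep_hom M I),
    mono_in C i -> exists h : rep_hom N I, hom_eq (hom_comp h i) f.

Definition indecomposable_in (C : rep k Q -> Prop) M : Prop :=
  [/\ C M, ~ is_zero M &
      forall N L, C N -> C L -> isomorphic M (dsum N L) ->
        is_zero N \/ is_zero L].

(* the representation [P_a] *)
Definition proj_rep (a : vertex Q) : rep k Q :=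
  @Rep k Q (fun b => {malg k[qpath a b]} : lmodType k)
    (fun al => free_map (k := k) (@pcons Q a al)).

(* [P_(a_1) (+) ... (+) P_(a_n)] for [s = [:: a_1; ...; a_n]] *)
Definition proj_sum (s : seq (vertex Q)) : rep k Q :=
  foldr (fun a M => dsum (proj_rep a) M) zero_rep s.

Definition finitely_generated M : Prop :=
  exists (s : seq (vertex Q)) (f : rep_hom (proj_sum s) M), epi_in (fun=> True) f.

Definition finitely_presented M : Prop :=
  exists (s : seq (vertex Q)) (f : rep_hom (proj_sum s) M),
    epi_in (fun=> True) f /\ finitely_generated (ker_rep f).

Section Y.
Variable p : lpath Q.

Definition Y_obj (a : vertex Q) : lmodType k :=
  {linear {malg k[lclass p a]} -> k^o}.

(* [Y(al) f] is the linear form with value [f (u al)] at each [u]. *)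
Definition Y_map (al : arrow Q) (f : Y_obj (src al)) : Y_obj (tgt al) :=
  (f : {linear _ -> _}) \o free_map (k := k) (@lclass_cons Q p al).

Fact Y_map_linear al : linear (Y_map (al := al)).
Proof. by move=> c f g; apply: lin_eqP. Qed.
HB.instance Definition _ al := GRing.isLinear.Build k
  (Y_obj (src al)) (Y_obj (tgt al)) _ (Y_map (al := al)) (@Y_map_linear al).

Definition Y_rep : rep k Q := @Rep k Q Y_obj (fun al => Y_map (al := al)).
End Y.

End Category.
Arguments Y_rep k {Q} p.

(* Main.v *)
(** Let [a_j] be the source of the tail [p_j] of [p] from its [j]-th arrow on.
    Interval finiteness excludes oriented cycles, so every element of [[p]_a]
    is, for all large [j], of the form [p_j pi] with a unique path
    [pi : a -> a_j]. Hence [Hom(N, Y_[p])] is the dual of the filtered colimit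
    of the [N(a_j)], and extending a morphism along a monomorphism amounts to
    extending a linear form; monomorphisms of [fp(Q)] are pointwise injective
    because the [P_a] are finitely presented. The colimit is replaced by the
    product of the [N(a_j)], with sequences compared for large [j].

    If [Y_[p]] is finitely generated then [[p]_a] is finite, so the elements of
    [[p]_{a_0}] other than [p] leave [p] before some fixed step, and
    [[p]_{a_j} = {p_j}] for all large [j]. A nonzero subrepresentation of
    [Y_[p]] is nonzero at [a_j] for all large [j], where [Y_[p]] has
    dimension 1; so two nonzero subrepresentations meet. *)
From HB Require Import structures.
From mathcomp Require Import all_boot all_algebra.
From mathcomp Require Import boolp classical_sets functions.
From mathcomp Require Import cardinality.
From mathcomp Require Import finmap monalg.
Require Import Defs.

Set Implicit Arguments.
Unset Strict Implicit.
Unset Printing Implicit Defensive.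

Import GRing.Theory.
Local Open Scope classical_set_scope.
Local Open Scope ring_scope.

Definition mklin (k : fieldType) (U V : lmodType k) (f : U -> V)
    (f_lin : linear f) : {linear U -> V} :=
  HB.pack f (GRing.isLinear.Build k U V _ f f_lin).

Definition submodule (k : fieldType) (V : lmodType k) (G : set V) : Prop :=
  G 0 /\ forall (c : k) x y, G x -> G y -> G (c *: x + y).

Lemma separating_functional (k : fieldType) (V : lmodType k) (G0 : set V)
    (w : V) : submodule G0 -> ~ G0 w ->
  exists phi : {linear V -> k^o}, phi w = 1 /\ forall x, G0 x -> phi x = 0.
Proof.
move=> [G00 G0P] G0w.
pose P (A : set V) := submodule (G0 `|` A) /\ ~ (G0 `|` A) w.
have /Zorn_bigcup[A [[[_ GP] Gw] Amax]] : forall F : set (set V),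
    F `<=` P -> total_on F subset -> P (\bigcup_(X in F) X).
  move=> F FP Ftot; split; last first.
    by case=> // -[X FX Xw]; case: (FP X FX) => _; apply; right.
  split=> [|c x y]; first by left.
  have sub X : F X -> (G0 `|` X) x -> (G0 `|` X) y ->
      (G0 `|` \bigcup_(X in F) X) (c *: x + y).
    move=> FX Xx Xy; case: (FP X FX) => -[_ /(_ c x y Xx Xy)[?|?] _].
      by left.
    by right; exists X.
  case=> [Gx|[X FX Xx]] [Gy|[Y FY Yy]].
  - by left; apply: G0P.
  - by apply: (sub Y) => //; [left | right].
  - by apply: (sub X) => //; [right | left].
  - case: (Ftot X Y FX FY) => XY.
      by apply: (sub Y) => //; right=> //; apply: XY.
    by apply: (sub X) => //; right=> //; apply: XY.
set G := G0 `|` A in GP Gw.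
have G0G x : G0 x -> G x by left.
have G_0 : G 0 by apply: G0G.
have GZ c x : G x -> G (c *: x) by move=> Gx; rewrite -[c *: x]addr0; apply: GP.
have spanw x : exists c, G (x - c *: w).
  have [Gx|Gx] := pselect (G x); first by exists 0; rewrite scale0r subr0.
  pose G' := [set z | exists g c, G g /\ z = g + c *: x].
  have GG' z : G z -> G' z by exists z, 0; rewrite scale0r addr0.
  have G'x : G' x by exists 0, 1; rewrite add0r scale1r.
  have AG' : A `<` G'.
    split=> [z Az|/(_ x G'x) Ax]; [by apply: GG'; right | by apply: Gx; right].
  have G0G'E : G0 `|` G' = G'.
    by apply/seteqP; split=> [z|z G'z]; [case=> // /G0G /GG' | right].
  have [[g [c [Gg wE]]]|G'w] := pselect (G' w); last first.
    case: (Amax _ AG'); rewrite /P G0G'E; split=> //.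
    split=> [|d _ _ [g1 [c1 [Gg1 ->]]] [g2 [c2 [Gg2 ->]]]]; first exact: GG'.
    exists (d *: g1 + g2), (d * c1 + c2); split; first exact: GP.
    by rewrite scalerDr scalerDl scalerA addrACA.
  have cn0 : c != 0.
    by apply: contra_notN Gw => /eqP c0; rewrite wE c0 scale0r addr0.
  exists c^-1; have -> : x - c^-1 *: w = (- c^-1) *: g; last exact: GZ.
  rewrite wE scalerDr scalerA mulVf// scale1r opprD addrCA subrr addr0.
  by rewrite scaleNr.
have [phi phiP] := choice spanw.
have phi_uniq x c : G (x - c *: w) -> phi x = c.
  move=> Gxc; apply: contra_notP Gw => /eqP; rewrite -subr_eq0 => ncphi.
  have := GP (-1) _ _ (phiP x) Gxc.
  rewrite scaleN1r opprB addrA subrK.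
  rewrite -scalerBl => /(GZ (phi x - c)^-1).
  by rewrite scalerA mulVf// scale1r.
have phi_lin : linear (phi : V -> k^o).
  move=> c x y; apply: phi_uniq.
  have -> : c *: x + y - (c *: (phi x : k^o) + phi y) *: w =
     c *: (x - phi x *: w) + (y - phi y *: w).
    by rewrite scalerDl scalerBr scalerA opprD addrACA.
  exact: GP.
exists (mklin phi_lin); split; first by apply: phi_uniq; rewrite scale1r subrr.
by move=> x /G0G Gx; apply: phi_uniq; rewrite scale0r subr0.
Qed.

Section FreeExtension.
Variables (k : fieldType) (X : choiceType).

Lemma monalg_scale (c : k) (x : X) : << c *g x >> = c *: << x >>.
Proof. by apply/malgP => y; rewrite mcoeffZ !mcoeffU mulrnAr mulr1. Qed.

Lemma linear_malg_eq (V : lmodType k) (f g : {linear {malg k[X]} -> V}) :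
  (forall x, f << x >> = g << x >>) -> f =1 g.
Proof.
move=> fg u; rewrite [u]monalgE !linear_sum; apply: eq_bigr => x _.
by rewrite monalg_scale !linearZ fg.
Qed.

Variables (V : lmodType k) (g : X -> V).

Definition lin_ext (u : {malg k[X]}) : V := \sum_(x <- msupp u) u@_x *: g x.

Fact lin_ext_linear : linear lin_ext.
Proof.
have Fw (d : {fset X}) (u : {malg k[X]}) : (msupp u `<=` d)%fset ->
    lin_ext u = \sum_(x <- d) u@_x *: g x.
  move=> sud; apply: big_fset_incl => // x _ /mcoeff_outdom ->.
  by rewrite scale0r.
move=> c u v; pose d := (msupp u `|` msupp v)%fset.
rewrite (Fw d u) ?fsubsetUl// (Fw d v) ?fsubsetUr// (Fw d); last first.
  by apply: fsubset_trans (msuppD_le _ _) _; apply: fsetSU; apply: msuppZ_le.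
rewrite scaler_sumr -big_split /=.
by apply: eq_bigr => x _; rewrite mcoeffD mcoeffZ scalerDl scalerA.
Qed.
HB.instance Definition _ := GRing.isLinear.Build k {malg k[X]} V _
  lin_ext lin_ext_linear.

Lemma lin_extU x : lin_ext << x >> = g x.
Proof.
rewrite /lin_ext msuppU oner_eq0 big_seq_fset1 mcoeffUU.
exact: scale1r.
Qed.

End FreeExtension.

Lemma free_mapU (k : fieldType) (X Y : choiceType) (g : X -> Y) (x : X) :
  free_map g << x >> = << g x >> :> {malg k[Y]}.
Proof. by rewrite /free_map msuppU oner_eq0 big_seq_fset1 mcoeffUU. Qed.

Section PairInjections.
Variables (k : fieldType) (U V : lmodType k).

Lemma pairE (x : U) (y : V) : (x, y) = (x, 0) + (0, y).
Proof. by rewrite /GRing.add /= /add_pair /= addr0 add0r. Qed.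

Fact inl_linear : linear (fun x : U => (x, 0 : V)).
Proof.
move=> c x y.
by rewrite /GRing.scale /= /scale_pair /GRing.add /= /add_pair /= scaler0 addr0.
Qed.
Definition inl_lin := mklin inl_linear.

Fact inr_linear : linear (fun y : V => (0 : U, y)).
Proof.
move=> c x y.
by rewrite /GRing.scale /= /scale_pair /GRing.add /= /add_pair /= scaler0 addr0.
Qed.
Definition inr_lin := mklin inr_linear.

End PairInjections.

Lemma existT_inj (T : Type) (P : T -> Type) (x : T) (y z : P x) :
  existT P x y = existT P x z -> y = z.
Proof.
move=> e; have := projT2_eq e.
by rewrite (Prop_irrelevance (projT1_eq e) erefl).
Qed.

Section Paths.
Variable Q : quiver.
Implicit Types (a b c : vertex Q) (al : arrow Q).

Fixpoint plen a b (pi : qpath a b) : nat :=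
  if pi is pcons _ pi' then (plen pi').+1 else 0.

Fixpoint psnoc al b (pi : qpath (tgt al) b) : qpath (src al) b :=
  match pi with
  | ptriv => pcons (ptriv (src al))
  | pcons _ pi' => pcons (psnoc pi')
  end.

Lemma plen_psnoc al b (pi : qpath (tgt al) b) : plen (psnoc pi) = (plen pi).+1.
Proof. by elim: pi => [|be pi] //= ->. Qed.

Lemma lpath_eq (u v : lpath Q) : u =1 v -> u = v.
Proof.
case: u v => [u uP] [v vP] /= /funext uv; subst v.
by rewrite (Prop_irrelevance uP vP).
Qed.

Section Lclass.
Variable p : lpath Q.

Lemma lclass_eq a (u v : lclass p a) : lclass_val u =1 lclass_val v -> u = v.
Proof.
case: u v => [u uE us] [v vE vs] /= /lpath_eq uv; subst v.
by rewrite (Prop_irrelevance uE vE) (Prop_irrelevance us vs).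
Qed.

Fixpoint pcat a b (pi : qpath a b) : lclass p b -> lclass p a :=
  match pi with
  | ptriv => id
  | pcons _ pi' => fun v => pcat pi' (lclass_cons v)
  end.

Lemma pcat_shift a b (pi : qpath a b) (v : lclass p b) i :
  lclass_val (pcat pi v) (plen pi + i)%N = lclass_val v i.
Proof.
elim: pi v i => [|al pi IH] v i //=.
by rewrite addSnnS IH.
Qed.

Lemma pcat_prefix a b (pi : qpath a b) (v w : lclass p b) i :
  (i < plen pi)%N -> lclass_val (pcat pi v) i = lclass_val (pcat pi w) i.
Proof.
elim: pi v w => [|al pi IH] v w //=; rewrite ltnS leq_eqVlt => /orP[/eqP ->|].
  by rewrite -[plen pi]addn0 !pcat_shift.
exact: IH.
Qed.

Lemma pcat_psnoc al b (pi : qpath (tgt al) b) (v : lclass p b) :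
  pcat (psnoc pi) v = lclass_cons (pcat pi v).
Proof.
by elim: pi v => [|be pi IH] v //=.
Qed.

Lemma pcat_inj_len a b b' (pi : qpath a b) (pi' : qpath a b') v v' :
  plen pi = plen pi' -> lclass_val (pcat pi v) =1 lclass_val (pcat pi' v') ->
  existT (qpath a) b pi = existT (qpath a) b' pi'.
Proof.
elim: pi b' pi' v v' => [|al pi IH] b' [|al' pi'] v v' //= [lenE] valE.
have alE : al = al'.
  have := valE (plen pi + 0)%N; rewrite pcat_shift lenE pcat_shift.
  exact.
subst al'; have := IH _ _ _ _ lenE valE.
by move=> e; rewrite (existT_inj e).
Qed.

Fact ltail_proof j i : src (p (i.+1 + j)) = tgt (p (i + j)).
Proof. exact: larrowP. Qed.

Definition ltail j : lclass p (src (p j)).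
Proof.
apply: (@LClass Q p _ (LPath (ltail_proof j)) _ erefl).
by exists j, 0%N => i /=; rewrite addnC.
Defined.

Lemma ltailE j i : lclass_val (ltail j) i = p (i + j)%N.
Proof. by []. Qed.

Lemma lclass_factor l a b (u : lclass p a) (v : lclass p b) :
  (forall i, lclass_val u (l + i)%N = lclass_val v i) ->
  exists pi : qpath a b, plen pi = l /\ u = pcat pi v.
Proof.
elim: l a u => [|l IH] a u uv.
  have ab : a = b.
    by rewrite -(lclass_src u) -(lclass_src v) /lsrc -uv.
  subst b; exists (ptriv a); split=> //=.
  exact: lclass_eq.
case: u uv => [u [m [n e]] us] /= uv; subst a.
have u'P i : src (u i.+2) = tgt (u i.+1) by exact: larrowP.
have u'E : lequiv p (LPath u'P).
  by exists m.+1, n => i; rewrite addSnnS e addnS.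
pose u' : lclass p (tgt (u 0%N)) := LClass u'E (larrowP u 0).
have [|pi [<- uE]] := IH _ u'; first by move=> i; exact: uv.
exists (psnoc pi); split; first exact: plen_psnoc.
by rewrite pcat_psnoc -uE; apply: lclass_eq => -[].
Qed.

Lemma ltail_factor i j : (i <= j)%N ->
  exists pi : qpath (src (p i)) (src (p j)),
    plen pi = (j - i)%N /\ ltail i = pcat pi (ltail j).
Proof.
by move=> ij; apply: lclass_factor => l; rewrite !ltailE addnAC subnK// addnC.
Qed.

Lemma lclass_factor_tail a (u : lclass p a) :
  exists J, forall j, (J <= j)%N ->
    exists pi : qpath a (src (p j)), u = pcat pi (ltail j).
Proof.
have [m [n e]] := lclass_equiv u; exists m => j mj.
have [|pi [_ ->]] := @lclass_factor (n + (j - m)) _ _ u (ltail j).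
  by move=> i; rewrite ltailE -addnA -e addnA subnKC// addnC.
by exists pi.
Qed.

Hypothesis hQ : interval_finite Q.

Lemma plen_bounded a b : exists n, forall pi : qpath a b, (plen pi < n)%N.
Proof.
have [X XE] := finite_fsetP.1 (hQ a b).
exists (\max_(pi <- X) plen pi).+1 => pi; rewrite ltnS.
have piX : pi \in X by have : [set: qpath a b] pi by []; rewrite XE.
by rewrite (big_fsetD1 pi)//= leq_maxl.
Qed.

Lemma lclass_aperiodic a (u : lclass p a) (l d : nat) : (0 < d)%N ->
  ~ forall i, lclass_val u (l + i)%N = lclass_val u (l + d + i)%N.
Proof.
case: u => [u ue ua] d0 /= uE; subst a.
have uEt t i : u (l + i)%N = u (l + t * d + i)%N.
  elim: t => [|t IH]; first by rewrite addn0.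
  by rewrite IH -addnA uE mulSn -!addnA.
have path n : exists pi : qpath (lsrc u) (src (u n)), plen pi = n.
  elim: n => [|n [pi piE]].
    by exists (ptriv _).
  by rewrite (larrowP u n); exists (pcons pi); rewrite /= piE.
have [n nP] := plen_bounded (lsrc u) (src (u l)).
have := path (l + n * d)%N; rewrite -[(l + n * d)%N]addn0 -uEt !addn0.
move=> [pi piE]; have := nP pi; rewrite piE ltnNge.
by rewrite (leq_trans (leq_pmulr n d0))// leq_addl.
Qed.

Lemma pcat_inj a b (v : lclass p b) (pi pi' : qpath a b) :
  pcat pi v = pcat pi' v -> pi = pi'.
Proof.
move=> e; suff lenE : plen pi = plen pi'.
  by apply: existT_inj; apply: (@pcat_inj_len _ _ _ pi pi' v v lenE); rewrite e.
wlog le : pi pi' e / (plen pi <= plen pi')%N.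
  by move=> W; case/orP: (leq_total (plen pi) (plen pi')) => /W ->.
apply/eqP; rewrite eqn_leq le leqNgt; apply/negP => lt.
apply: (@lclass_aperiodic a (pcat pi v) (plen pi) (plen pi' - plen pi)).
  by rewrite subn_gt0.
by move=> i; rewrite pcat_shift subnKC// e pcat_shift.
Qed.

Lemma lclass_tail_singleton : finite_set [set: lclass p (src (p 0%N))] ->
  exists J, forall j, (J <= j)%N ->
    forall v : lclass p (src (p j)), v = ltail j.
Proof.
move=> /finite_fsetP[X XE].
have /choice[d dP] : forall u : lclass p (src (p 0%N)), exists n,
    u <> ltail 0 -> lclass_val u n <> p n.
  move=> u; have [->|/eqP un] := eqVneq u (ltail 0); first by exists 0%N.
  suff : ~ forall n, lclass_val u n = p n.
    by move=> /existsNP[n nP]; exists n.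
  by move=> uE; apply: un; apply: lclass_eq => n; rewrite ltailE uE addn0.
exists (\max_(u <- X) d u).+1 => j Jj v.
have [pi [pij piE]] := ltail_factor (leq0n j); rewrite subn0 in pij.
pose u := pcat pi v.
have uX : u \in X by have : [set: lclass p (src (p 0%N))] u by []; rewrite XE.
have du : (d u < j)%N.
  by apply: leq_trans Jj; rewrite ltnS (big_fsetD1 u)//= leq_maxl.
have uE : u = ltail 0.
  have [//|/eqP/dP] := eqVneq u (ltail 0); case.
  by rewrite (@pcat_prefix _ _ _ _ (ltail j)) ?pij// -piE ltailE addn0.
apply: lclass_eq => i.
by rewrite -(pcat_shift pi) -/u uE piE pcat_shift.
Qed.

End Lclass.
End Paths.

Section Reps.
Variables (k : fieldType) (Q : quiver).
Implicit Types M N L : rep k Q.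

Fixpoint act M a b (pi : qpath a b) : {linear M a -> M b} :=
  match pi with
  | ptriv => idfun
  | pcons al pi' => rep_map M al \o act M pi'
  end.
Arguments act M {a b} pi.

Lemma act_psnoc M al b (pi : qpath (tgt al) b) x :
  act M (psnoc pi) x = act M pi (rep_map M al x).
Proof. by elim: pi => [|be pi /= ->]. Qed.

Lemma hom_act M N (f : rep_hom M N) a b (pi : qpath a b) x :
  f b (act M pi x) = act N pi (f a x).
Proof. by elim: pi => [|be pi /= <-] //=; rewrite homP. Qed.

Lemma Y_act (p : lpath Q) a b (pi : qpath a b) (y : Y_obj k p a) v :
  (act (Y_rep k p) pi y : Y_obj k p b) << v >> = y << pcat pi v >>.
Proof.
elim: pi v => [|al pi IH] v //=.
by rewrite /Y_map /= free_mapU IH.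
Qed.

Section ProjHom.
Variables (M : rep k Q) (a : vertex Q) (x : M a).

Fact proj_homP (al : arrow Q) (u : proj_rep k a (src al)) :
  lin_ext (fun pi : qpath a (tgt al) => act M pi x)
    (rep_map (proj_rep k a) al u)
  = rep_map M al (lin_ext (fun pi : qpath a (src al) => act M pi x) u).
Proof.
have := @linear_malg_eq k _ _
  (lin_ext (fun pi : qpath a _ => act M pi x) \o rep_map (proj_rep k a) al)
  (rep_map M al \o lin_ext (fun pi : qpath a _ => act M pi x)).
by apply=> pi /=; rewrite free_mapU !lin_extU.
Qed.

Definition proj_hom : rep_hom (proj_rep k a) M :=
  @Hom k Q (proj_rep k a) M
    (fun b => lin_ext (fun pi : qpath a b => act M pi x)) proj_homP.

Lemma proj_homE : proj_hom a << ptriv a >> = x.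
Proof. by rewrite /= lin_extU. Qed.
End ProjHom.

Lemma proj_rep_fp (a : vertex Q) : finitely_presented (proj_rep k a).
Proof.
pose f b := mklin (fun c x y => erefl :
  (c *: (x : dsum (proj_rep k a) (zero_rep k Q) b) + y).1 = c *: x.1 + y.1).
have fP (al : arrow Q) (x : dsum (proj_rep k a) (zero_rep k Q) (src al)) :
    f (tgt al) (rep_map _ al x) = rep_map (proj_rep k a) al (f (src al) x).
  by [].
exists [:: a], (@Hom k Q (dsum (proj_rep k a) (zero_rep k Q)) _ f fP); split.
  move=> L _ g h gh b x; exact: (gh b (x, 0)).
exists [::].
pose z b : {linear zero_rep k Q b -> ker_rep (Hom fP) b} := \0.
have zP (al : arrow Q) (x : zero_rep k Q (src al)) :
    z (tgt al) (rep_map _ al x) = rep_map (ker_rep (Hom fP)) al (z (src al) x).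
  by rewrite [RHS]linear0.
exists (@Hom k Q (zero_rep k Q) _ z zP) => L _ g h _ b x.
suff -> : x = 0 by rewrite !linear0.
apply: val_inj; have /eqP := valP x; case: (val x) => y w /= y0.
by rewrite y0 (thinmx0 w).
Qed.

Lemma mono_fp_injective M N (i : rep_hom M N) :
  mono_in (@finitely_presented k Q) i -> forall a x, i a x = 0 -> x = 0.
Proof.
move=> imono a x ix0.
have ixE : hom_eq (hom_comp i (proj_hom x)) (hom_comp i (proj_hom 0)).
  move=> b.
  apply: (@linear_malg_eq _ _ _ (i b \o proj_hom x b) (i b \o proj_hom 0 b)).
  by move=> pi; rewrite /= !lin_extU !hom_act ix0 !linear0.
have := imono _ (proj_rep_fp a) _ _ ixE a << ptriv a >>.
by rewrite !proj_homE.
Qed.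

End Reps.
Arguments act {k Q} M {a b} pi.

Section Coinduced.
Variables (k : fieldType) (Q : quiver) (a : vertex Q).

Definition inj_obj (b : vertex Q) : lmodType k := qpath b a -> k^o.

Fact inj_map_linear al :
  linear ((fun f pi => f (psnoc pi)) : inj_obj (src al) -> inj_obj (tgt al)).
Proof. by []. Qed.
Definition inj_map al := mklin (@inj_map_linear al).

(* the injective representation [I_a]; [Hom(N, I_a)] is the dual of [N(a)] *)
Definition inj_rep : rep k Q := @Rep k Q inj_obj inj_map.

Variables (N : rep k Q) (phi : {linear N a -> k^o}).

Fact inj_hom_linear b :
  linear (fun x => (fun pi : qpath b a => phi (act N pi x)) : inj_obj b).
Proof. by move=> c x y; apply/funext => pi; rewrite !linearP. Qed.

Fact inj_homP (al : arrow Q) (x : N (src al)) :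
  mklin (@inj_hom_linear (tgt al)) (rep_map N al x)
  = rep_map inj_rep al (mklin (@inj_hom_linear (src al)) x).
Proof. by apply/funext => pi /=; rewrite act_psnoc. Qed.

Definition inj_hom : rep_hom N inj_rep :=
  @Hom k Q N inj_rep (fun b => mklin (@inj_hom_linear b)) inj_homP.

End Coinduced.

Lemma epi_functional (k : fieldType) (Q : quiver) (M N : rep k Q)
    (f : rep_hom M N) a (phi : {linear N a -> k^o}) :
  epi_in (fun=> True) f -> (forall x, phi (f a x) = 0) -> forall y, phi y = 0.
Proof.
move=> fepi phif y.
have e : hom_eq (hom_comp (inj_hom phi) f) (hom_comp (inj_hom \0) f).
  by move=> b x; apply/funext => pi /=; rewrite -hom_act phif.
by have /(congr1 (fun g => g (ptriv a))) := fepi _ Logic.I _ _ e a y.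
Qed.

Lemma proj_sum_spanned (k : fieldType) (Q : quiver) (hQ : interval_finite Q)
    (s : seq (vertex Q)) (a : vertex Q) :
  exists e : seq (proj_sum k s a), forall phi : {linear proj_sum k s a -> k^o},
    {in e, forall x, phi x = 0} -> forall x, phi x = 0.
Proof.
elim: s => [|b s [e eP]].
  by exists [::] => phi _ x; rewrite (thinmx0 (x : 'rV_0)) linear0.
have [X XE] := finite_fsetP.1 (hQ b a).
exists ([seq (<< pi >>, 0) | pi <- X] ++ [seq (0, x) | x <- e]) => phi phi0.
have phi1 : phi \o inl_lin _ _ =1 (\0 : {linear _ -> _}).
  apply: (@linear_malg_eq _ _ _ (phi \o inl_lin _ _)) => pi /=.
  apply: phi0; rewrite mem_cat map_f//.
  by have : [set: qpath b a] pi by []; rewrite XE.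
have phi2 x : (phi \o inr_lin _ _) x = 0.
  apply: (eP (phi \o inr_lin _ _)) => y ye; apply: phi0.
  by rewrite mem_cat [X in _ || X]map_f ?orbT.
by move=> [x y]; rewrite pairE linearD [phi (x, 0)]phi1 [phi (0, y)]phi2 addr0.
Qed.

Lemma fg_Y_finite (k : fieldType) (Q : quiver) (hQ : interval_finite Q)
    (p : lpath Q) (a : vertex Q) :
  finitely_generated (Y_rep k p) -> finite_set [set: lclass p a].
Proof.
move=> [s [f fepi]]; have [e eP] := proj_sum_spanned k hQ s a.
apply: contrapT => /(infinite_set_fset (size e).+1)[B _ rB].
have [v0 _] : exists v, v \in B.
  by apply/fset0Pn; rewrite -cardfs_gt0; apply: leq_trans rB.
pose r := size e; pose u (i : 'I_r.+1) := nth v0 B i.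
have u_inj : injective u.
  move=> i j /eqP; rewrite nth_uniq ?fset_uniq// ?(leq_trans (ltn_ord _) rB)//.
  by move=> /eqP /val_inj.
pose y (j : 'I_r) : Y_obj k p a := f a e`_j.
pose A := \matrix_(i < r.+1, j < r) (y j << u i >>).
have [c cA c0] : exists2 c : 'rV[k]_r.+1, c *m A = 0 & c != 0.
  have /rowV0Pn[c /sub_kermxP cA c0] : kermx A != 0; last by exists c.
  by rewrite -mxrank_eq0 mxrank_ker subn_eq0 -ltnNge ltnS rank_leq_col.
pose g (z : Y_obj k p a) : k^o := \sum_(i < r.+1) c 0 i *: (z << u i >> : k^o).
have glin : linear g.
  move=> d x z; rewrite /g scaler_sumr -big_split; apply: eq_bigr => i _ /=.
  by rewrite scalerDr !scalerA mulrC.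
have gf x : mklin glin (f a x) = 0.
  apply: (eP (mklin glin \o f a)) => z /(nthP 0)[j jr <-] /=.
  have /matrixP/(_ 0 (Ordinal jr)) := cA; rewrite !mxE => cAj.
  by rewrite -[RHS]cAj; apply: eq_bigr => i _; rewrite mxE.
have g0 := epi_functional fepi gf.
case/rV0Pn: c0 => i; case/eqP.
have := g0 (lin_ext (fun v => (v == u i)%:R : k^o)).
rewrite /= /g (bigD1 i)//= lin_extU eqxx big1 => [|j ji].
  by rewrite addr0 [_ *: _]mulr1.
rewrite lin_extU; case: eqP => [uij|_]; last by rewrite scaler0.
by case/eqP: ji; apply: u_inj.
Qed.

Section DepProduct.
Variables (k : fieldType) (I : Type) (V : I -> lmodType k).

Definition dprod : Type := forall i, V i.
HB.instance Definition _ := gen_eqMixin dprod.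
HB.instance Definition _ := gen_choiceMixin dprod.

Implicit Types f g : dprod.
Let add f g : dprod := fun i => f i + g i.
Let opp f : dprod := fun i => - f i.
Let zero : dprod := fun=> 0.
Let scale (c : k) f : dprod := fun i => c *: f i.

Fact dprod_addA : associative add.
Proof.
by move=> f g h; apply/functional_extensionality_dep => i; exact: addrA.
Qed.
Fact dprod_addC : commutative add.
Proof.
by move=> f g; apply/functional_extensionality_dep => i; exact: addrC.
Qed.
Fact dprod_add0 : left_id zero add.
Proof.
by move=> f; apply/functional_extensionality_dep => i; exact: add0r.
Qed.
Fact dprod_addN : left_inverse zero opp add.
Proof.
by move=> f; apply/functional_extensionality_dep => i; exact: addNr.
Qed.
HB.instance Definition _ := GRing.isZmodule.Build dprod
  dprod_addA dprod_addC dprod_add0 dprod_addN.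

Fact dprod_scaleA a b f : scale a (scale b f) = scale (a * b) f.
Proof. by apply/functional_extensionality_dep => i; exact: scalerA. Qed.
Fact dprod_scale1 : left_id 1 scale.
Proof.
by move=> f; apply/functional_extensionality_dep => i; exact: scale1r.
Qed.
Fact dprod_scaleDr : right_distributive scale +%R.
Proof.
by move=> a f g; apply/functional_extensionality_dep => i; exact: scalerDr.
Qed.
Fact dprod_scaleDl f : {morph scale^~ f : a b / a + b}.
Proof.
by move=> a b; apply/functional_extensionality_dep => i; exact: scalerDl.
Qed.
HB.instance Definition _ := GRing.Zmodule_isLmodule.Build k dprod
  dprod_scaleA dprod_scale1 dprod_scaleDr dprod_scaleDl.

End DepProduct.

Section Extension.
Variables (k : fieldType) (Q : quiver) (hQ : interval_finite Q) (p : lpath Q).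
Variables (M N : rep k Q) (i : rep_hom M N) (f : rep_hom M (Y_rep k p)).
Hypothesis i_inj : forall a x, i a x = 0 -> x = 0.

Definition germs : lmodType k := dprod (fun j => N (src (p j))).

Definition germ a (u : lclass p a) (n : N a) : germs := fun j =>
  if pselect (exists pi : qpath a (src (p j)), u = pcat pi (ltail p j))
    is left e
  then act N (projT1 (cid e)) n else 0.

Lemma germE a (u : lclass p a) n j (pi : qpath a (src (p j))) :
  u = pcat pi (ltail p j) -> germ u n j = act N pi n.
Proof.
move=> uE; rewrite /germ; case: pselect => [e|[]]; last by exists pi.
by case: cid => pi' /= uE'; rewrite (pcat_inj hQ (etrans (esym uE') uE)).
Qed.

Lemma germ_linear a (u : lclass p a) : linear (germ u).
Proof.
move=> c x y; apply/functional_extensionality_dep => j.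
rewrite [RHS]/GRing.add /= /GRing.scale /= /germ.
by case: pselect => [e|_]; [rewrite linearP | rewrite scaler0 addr0].
Qed.

(* the graph of [f], on the sequences that eventually come from [M] *)
Let G (z : (germs * k^o)%type) : Prop := exists J, forall j, (J <= j)%N ->
  exists2 m : M (src (p j)), z.1 j = i _ m &
    z.2 = (f _ m : Y_obj k p _) << ltail p j >>.

Let G_submodule : submodule G.
Proof.
split; first by exists 0%N => j _; exists 0; rewrite !linear0.
move=> c x y [J1 P1] [J2 P2]; exists (maxn J1 J2) => j.
rewrite geq_max => /andP[/P1[m1 e1 e1'] /P2[m2 e2 e2']].
exists (c *: m1 + m2); first by rewrite [RHS]linearP -e1 -e2.
by rewrite [f _ _]linearP /= -e1' -e2'.
Qed.

Let G_proper : ~ G (0, 1).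
Proof.
move=> [J /(_ J (leqnn J))[m /= /esym/i_inj ->]].
by rewrite linear0 => /eqP; rewrite oner_eq0.
Qed.

Lemma Y_extension : exists h : rep_hom N (Y_rep k p), hom_eq (hom_comp h i) f.
Proof.
have [psi [psi1 psi0]] := separating_functional G_submodule G_proper.
have psiN s c : psi (s, c) = psi (s, 0) + c.
  have cE : (0, c) = c *: (0, 1) :> germs * k^o.
    rewrite -[RHS]/(c *: (0 : germs), c *: (1 : k^o)) scaler0.
    by rewrite [_ *: _]mulr1.
  by rewrite pairE linearD cE linearZ psi1 [X in _ + X]mulr1.
have [chi chiG] : exists chi : {linear germs -> k^o},
    forall s c, G (s, c) -> chi s = c.
  exists (\- (psi \o inl_lin _ _)) => s c /psi0.
  by rewrite psiN => /eqP; rewrite addrC addr_eq0 => /eqP ->.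
pose H b (n : N b) : Y_obj k p b := lin_ext (fun u => chi (germ u n)).
have H_lin b : linear (@H b).
  move=> c x y; apply: lin_eqP; apply: linear_malg_eq => u.
  by rewrite /= !lin_extU germ_linear linearP.
have HP (al : arrow Q) (n : N (src al)) :
    mklin (@H_lin (tgt al)) (rep_map N al n)
    = rep_map (Y_rep k p) al (mklin (@H_lin (src al)) n).
  apply: lin_eqP; apply: linear_malg_eq => u.
  rewrite /= /H /Y_map /= free_mapU !lin_extU.
  apply/eqP; rewrite -subr_eq0 -linearB; apply/eqP/chiG.
  have [J JP] := lclass_factor_tail u; exists J => j /JP[pi uE].
  exists 0; last by rewrite linear0.
  rewrite linear0 /GRing.add /= /GRing.opp /= (germE _ uE).
  rewrite (@germE _ _ _ _ (psnoc pi)) ?pcat_psnoc -?uE//.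
  by rewrite act_psnoc subrr.
exists (@Hom k Q N (Y_rep k p) (fun b => mklin (@H_lin b)) HP) => b m.
apply: lin_eqP; apply: linear_malg_eq => u.
rewrite /= lin_extU; apply: chiG.
have [J JP] := lclass_factor_tail u; exists J => j /JP[pi uE].
exists (act M pi m); first by rewrite /= hom_act (germE _ uE).
by rewrite /= hom_act Y_act -uE.
Qed.

End Extension.

Lemma Y_supports (k : fieldType) (Q : quiver) (p : lpath Q) (N : rep k Q)
    (f : rep_hom N (Y_rep k p)) (a : vertex Q) (x : N a) : f a x != 0 ->
  exists J, forall j, (J <= j)%N -> exists x' : N (src (p j)), f _ x' != 0.
Proof.
move=> fx; have [u fu] : exists u, (f a x : Y_obj k p a) << u >> != 0.
  apply: contra_neqP fx => /forallNP fx0; apply: lin_eqP.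
  by apply: linear_malg_eq => u; apply/eqP/negPn/negP/fx0.
have [J JP] := lclass_factor_tail u; exists J => j /JP[pi uE].
exists (act N pi x); apply: contra_neq fu => fx0.
by rewrite uE -Y_act -hom_act fx0.
Qed.

Lemma Y_indecomposable (k : fieldType) (Q : quiver) (hQ : interval_finite Q)
    (p : lpath Q) (N L : rep k Q) : finitely_generated (Y_rep k p) ->
  isomorphic (Y_rep k p) (dsum N L) -> is_zero N \/ is_zero L.
Proof.
move=> Yfg [f [g [gf fg]]].
have [J0 J0P] := lclass_tail_singleton (fg_Y_finite hQ (src (p 0%N)) Yfg).
have g_inj a z : g a z = 0 -> z = 0.
  by move=> gz; have := fg a z; rewrite /= gz linear0.
apply: contrapT => /not_orP[].
move=> /existsNP[a /existsNP[x /eqP x0]] /existsNP[b /existsNP[y /eqP y0]].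
have inlP (al : arrow Q) (z : N (src al)) :
  g _ (rep_map N al z, 0) = rep_map (Y_rep k p) al (g _ (z, 0)).
  by rewrite -homP /= /dsum_map /= linear0.
have inrP (al : arrow Q) (z : L (src al)) :
  g _ (0, rep_map L al z) = rep_map (Y_rep k p) al (g _ (0, z)).
  by rewrite -homP /= /dsum_map /= linear0.
pose gl := @Hom k Q N (Y_rep k p) (fun c => g c \o inl_lin _ _) inlP.
pose gr := @Hom k Q L (Y_rep k p) (fun c => g c \o inr_lin _ _) inrP.
have [J1 J1P] : exists J, forall j, (J <= j)%N ->
    exists z, gl (src (p j)) z != 0.
  by apply: (@Y_supports _ _ _ _ gl a x); apply: contra_neq x0 => /g_inj[].
have [J2 J2P] : exists J, forall j, (J <= j)%N ->
    exists z, gr (src (p j)) z != 0.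
  by apply: (@Y_supports _ _ _ _ gr b y); apply: contra_neq y0 => /g_inj[].
pose j := maxn J0 (maxn J1 J2).
have [j0 j1 j2] : [/\ J0 <= j, J1 <= j & J2 <= j]%N.
  by split; rewrite /j !leq_max leqnn ?orbT.
have [x' gx'] := J1P j j1; have [y' gy'] := J2P j j2.
pose ev (z : Y_obj k p (src (p j))) : k := z << ltail p j >>.
have ev_inj z w : ev z = ev w -> z = w.
  move=> zw; apply: lin_eqP; apply: linear_malg_eq => u.
  by rewrite (J0P j j0 u).
have /g_inj[_ /eqP] :
    g (src (p j)) (ev (gr _ y') *: x', - ev (gl _ x') *: y') = 0.
  have -> : (ev (gr _ y') *: x', - ev (gl _ x') *: y')
      = inl_lin _ _ (ev (gr _ y') *: x') + inr_lin _ _ (- ev (gl _ x') *: y').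
    exact: pairE.
  rewrite linearD !linearZ; apply: ev_inj.
  change (ev (gr _ y') * ev (gl _ x') + - ev (gl _ x') * ev (gr _ y') = 0).
  by rewrite mulNr mulrC subrr.
rewrite scaler_eq0 oppr_eq0 => /orP[/eqP gx0|/eqP y'0].
  by case/eqP: gx'; apply: ev_inj; rewrite gx0.
by case/eqP: gy'; rewrite y'0 linear0.
Qed.

Theorem proposition3p10 (k : fieldType) (Q : quiver) (hQ : interval_finite Q)
    (p : lpath Q) (hY : finitely_presented (Y_rep k p)) :
  indecomposable_in (@finitely_presented k Q) (Y_rep k p) /\
  injective_in (@finitely_presented k Q) (Y_rep k p).
Proof.
have Yfg : finitely_generated (Y_rep k p).
  by have [s [f [fepi _]]] := hY; exists s, f.
split; [split=> // | split=> //].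
- move=> Y0; pose y : Y_obj k p (src (p 0%N)) := lin_ext (fun=> 1 : k^o).
  have y1 : y << ltail p 0 >> = 1 by exact: lin_extU.
  by move: y1; rewrite (Y0 _ y) => /esym/eqP; rewrite oner_eq0.
- by move=> N L _ _; exact: Y_indecomposable.
- by move=> M N _ _ i f /mono_fp_injective i_inj; exact: Y_extension.
Qed.
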